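(* Let $r\geq 2$, $t\geq 1$, $n,k$ be positive integers with $n\geq\max\left\{2k,\ \frac{t(t-1)}{2\log 2}+2t-1\right\}$ and $t\leq 2^{r-2}\log 2-2$ ($\log$ the natural logarithm). Then \[ m(n,k,r,t)=\binom{n-t}{k-t}. \] Moreover, if $\mathcal{F}\subset\binom{[n]}{k}$ is $r$-wise $t$-intersecting with $|\mathcal{F}|=\binom{n-t}{k-t}$, then $\mathcal{F}$ is a full $t$-star, i.e. $\mathcal{F}=\{F\in\binom{[n]}{k}:T\subset F\}$ for some $t$-element set $T\subset[n]$.
   Context: $\binom{[n]}{k}$ is the set of $k$-element subsets of $[n]=\{1,\dots,n\}$. A family $\mathcal{F}$ is $r$-wise $t$-intersecting if $|F_1\cap\dots\cap F_r|\geq t$ for all (not necessarily distinct) $F_1,\dots,F_r\in\mathcal{F}$. $m(n,k,r,t)$ is the maximum of $|\mathcal{F}|$ over all $r$-wise $t$-intersecting families $\mathcal{F}\subset\binom{[n]}{k}$. *)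

(* Defs.v *)
From mathcomp Require Import all_boot all_order all_algebra.

Set Implicit Arguments.
Unset Strict Implicit.
Unset Printing Implicit Defensive.

(* The ground set [n] = {1, ..., n} is represented by 'I_n = {0, ..., n-1};
   a family of subsets of [n] is a term of type {set {set 'I_n}}. *)

Definition k_uniform (n k : nat) (F : {set {set 'I_n}}) : bool :=
  F \subset [set A : {set 'I_n} | #|A| == k].

(* The r members need not be distinct. *)
Definition wise_intersecting (n r t : nat) (F : {set {set 'I_n}}) : bool :=
  [forall A : {ffun 'I_r -> {set 'I_n}},
    [forall i, A i \in F] ==> (t <= #|\bigcap_(i < r) A i|)].

(* The empty family always qualifies, so the maximum is attained. *)
Definition max_wise_intersecting (n k r t : nat) : nat :=
  \max_(F : {set {set 'I_n}} | k_uniform k F && wise_intersecting r t F) #|F|.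

Definition full_star (n k : nat) (T : {set 'I_n}) : {set {set 'I_n}} :=
  [set A : {set 'I_n} | (#|A| == k) && (T \subset A)].

(* Binomial coefficient with an integer lower index, equal to 0 when that index
   is negative; 'C(n - t, k - t) with truncated subtraction would be 1 when
   k < t. *)
Definition binz (n : nat) (j : int) : nat :=
  if j is Posz i then 'C(n, i) else 0.

(* Main.v *)
(* Shifting makes F left-compressed. By Frankl's lemma every A in F then satisfies
   |A ∩ [t + ri]| >= t + (r - 1)i for some i, i.e. its lattice path hits a line.
   A recursion on paths bounds the number of k-sets doing so by
   b^t C(n - t, k - t) whenever 2k <= n + t and 1 + b^r / 2^(r-1) <= b; the
   hypothesis on t allows b^t < 3/2. The star of [t] accounts for C(n - t, k - t)
   of these sets, so fewer than half as many members of F lie outside it. If there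
   is such a member, then no two members inside the star meet exactly in [t], so a
   Kneser graph argument leaves at most half of the star in F, and F is strictly
   smaller than the star. For uniqueness, a family that a shift turns into a star
   was itself a star. *)
Require Import Defs.
From mathcomp Require Import all_boot all_order all_algebra.
From mathcomp Require Import fingroup perm zify ring lra.
From mathcomp Require Import reals sequences exp.

Set Implicit Arguments.
Unset Strict Implicit.
Unset Printing Implicit Defensive.

Import Order.TTheory GRing.Theory Num.Theory.

(** * Stars and small intersections *)

(** The difference [A :\: T] ranges over the subsets of [D] of size [k - #|T|]. With [D] the
    complement of [T] this counts a star; with [D] the complement of a star member [P] it counts the
    star members meeting [P] exactly in [T]. *)
Lemma card_interval_star (n k : nat) (T D : {set 'I_n}) :
  [disjoint T & D] -> #|T| <= k ->
  #|[set A : {set 'I_n} | [&& #|A| == k, T \subset A & A \subset T :|: D]]|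
    = 'C(#|D|, k - #|T|).
Proof.
move=> dTD leTk; rewrite -cards_draws.
have dU (U : {set _}) : U \subset D -> U :&: T = set0.
  move=> UD; apply/setP=> x; rewrite !inE; apply/negP=> /andP[xU xT].
  by have := subsetP UD _ xU; rewrite (disjointFr dTD xT).
rewrite -[RHS](card_in_imset (f := fun U => T :|: U)); last first.
  move=> U V; rewrite !inE => /andP[UD _] /andP[VD _] /(congr1 (fun X => X :\: T)).
  rewrite !setDUl setDv !set0U => E.
  by rewrite -(setID U T) -(setID V T) E (dU _ UD) (dU _ VD).
apply: eq_card => A; rewrite !inE; apply/and3P/imsetP.
  case=> /eqP cA TA AD; exists (A :\: T).
    by rewrite !inE cardsDS // cA eqxx andbT subDset.
  by rewrite setDE setUIr setUCr setIT; apply/esym/setUidPr.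
case=> U; rewrite !inE => /andP[UD /eqP cU] ->.
rewrite subsetUl setUS // cardsU setIC dU // cards0 subn0 cU; split=> //.
by rewrite subnKC.
Qed.

Lemma card_full_star (n k : nat) (T : {set 'I_n}) :
  #|T| <= k -> #|full_star k T| = 'C(n - #|T|, k - #|T|).
Proof.
move=> leTk; have := @card_interval_star n k T (~: T).
rewrite -setI_eq0 setICr eqxx [#|~: T|]cardsCs setCK card_ord => <- //.
by apply: eq_card => A; rewrite !inE setUCr subsetT andbT.
Qed.

Lemma exists_subset_card (T : finType) (D : {set T}) (m : nat) :
  m <= #|D| -> exists2 U : {set T}, U \subset D & #|U| = m.
Proof.
rewrite -bin_gt0 -cards_draws card_gt0 => /set0Pn[U].
by rewrite inE => /andP[UD /eqP cU]; exists U.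
Qed.

Lemma wise_intersectingP (n r t : nat) (F : {set {set 'I_n}}) :
  reflect (forall A : 'I_r -> {set 'I_n}, (forall i, A i \in F) ->
             t <= #|\bigcap_(i < r) A i|)
          (wise_intersecting r t F).
Proof.
apply: (iffP forallP) => [H A AF | H A].
  have /implyP := H (finfun A); under eq_bigr do rewrite ffunE; apply.
  by apply/forallP => i; rewrite ffunE.
by apply/implyP => /forallP; apply: H.
Qed.

(** The remaining [r - 3] places are filled with copies of [C], since members may repeat. *)
Lemma wise_intersecting3 (n r t : nat) (F : {set {set 'I_n}}) A B C :
  2 < r -> wise_intersecting r t F -> A \in F -> B \in F -> C \in F ->
  t <= #|A :&: B :&: C|.
Proof.
case: r => [|[|[|r]]] // _ /wise_intersectingP H AF BF CF.
pose X (i : 'I_r.+3) := if i == 0 :> nat then A else if i == 1 :> nat then B else C.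
have XF i : X i \in F by rewrite /X; case: ifP => // _; case: ifP.
apply: leq_trans (H X XF) (subset_leq_card _).
have S i : \bigcap_i X i \subset X i by apply: bigcap_inf.
rewrite !subsetI; apply/andP; split; [apply/andP; split|].
- exact: (S ord0).
- by have := S (Ordinal (isT : 1 < r.+3)).
- by have := S (Ordinal (isT : 2 < r.+3)).
Qed.

(* With [P, Q] in [F] containing [T] and [G] in [F] not containing [T],
   [P :&: Q = T] is impossible; so [F] is an independent set in a regular graph
   of Kneser type on the star of [T], and such a set has density at most 1/2. *)
Lemma card_star_part (n k r t : nat) (F : {set {set 'I_n}}) (T G : {set 'I_n}) :
  2 < r -> wise_intersecting r t F -> #|T| = t -> t <= k -> 2 * k <= n + t ->
  G \in F -> ~~ (T \subset G) ->
  2 * #|F :&: full_star k T| <= 'C(n - t, k - t).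
Proof.
move=> r2 wF cT tk kn GF TG.
set S := full_star k T; set A := F :&: S.
have TGlt : #|T :&: G| < t.
  rewrite -cT; apply: proper_card; rewrite properE subsetIl /=.
  by apply: contra TG => /subset_trans; apply; apply: subsetIr.
(* The degree in the graph joining [P] and [Q] when [P :&: Q = T]: [Q :\: T] is any [(k - t)]-set
   outside [P]. It is positive because [2 * k <= n + t]. *)
pose d := 'C(n - k, k - t).
have d0 : 0 < d by rewrite bin_gt0; lia.
have deg P : P \in S -> \sum_(Q in S) (P :&: Q == T) = d.
  rewrite inE => /andP[/eqP cP TP].
  rewrite -big_mkcondr sum1dep_card.
  have dTP : [disjoint T & ~: P] by rewrite -setI_eq0 -subset0 -(setICr P) setSI.
  have := card_interval_star dTP; rewrite cT => /(_ k tk).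
  rewrite [#|~: P|]cardsCs setCK card_ord cP -/d => <-.
  apply: eq_card => Q; rewrite !inE.
  case: (#|Q| == k) => //=; have [TQ|] //= := boolP (T \subset Q).
  apply/eqP/idP => [E | sQ].
    apply/subsetP => x xQ; rewrite !inE -E inE xQ andbT orbN //.
  apply/setP=> x; rewrite inE; apply/andP/idP => [[xP xQ]|xT].
    by have := subsetP sQ _ xQ; rewrite !inE xP orbF.
  by rewrite (subsetP TP) // (subsetP TQ).
have E1 : \sum_(P in A) \sum_(Q in S) (P :&: Q == T) = #|A| * d.
  rewrite -sum_nat_const; apply: eq_bigr => P; rewrite inE => /andP[_]; exact: deg.
(* No edge lies inside [A]: its two ends and [G] would meet in [T :&: G], which has fewer than [t]
   elements. *)
have E2 : \sum_(P in A) \sum_(Q in S) (P :&: Q == T)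
            = \sum_(P in A) \sum_(Q in S :\: A) (P :&: Q == T).
  apply: eq_bigr => P PA; rewrite (big_setID A) /= big1 ?add0n // => Q.
  rewrite !inE => /andP[_ /andP[QF _]]; apply/eqP; rewrite eqb0; apply/eqP => E.
  move: PA; rewrite inE => /andP[PF _].
  by have := wise_intersecting3 r2 wF PF QF GF; rewrite E leqNgt TGlt.
(* All [#|A| * d] edge ends thus go to [S :\: A], where each vertex receives at most [d]. *)
have E3 : \sum_(P in A) \sum_(Q in S :\: A) (P :&: Q == T) <= #|S :\: A| * d.
  rewrite exchange_big -sum_nat_const; apply: leq_sum => Q.
  rewrite inE => /andP[_ QS]; rewrite -(deg Q QS) [leqRHS](big_setID A) /=.
  have -> : S :&: A = A by rewrite /A setICA setIid.
  by under eq_bigr do rewrite setIC; apply: leq_addr.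
have : #|A| <= #|S :\: A| by rewrite -(leq_pmul2r d0) -E1 E2.
have := cardsID A S; have -> : S :&: A = A by rewrite /A setICA setIid.
rewrite /S card_full_star ?cT //; lia.
Qed.

Lemma full_star_wise_intersecting n k r (T : {set 'I_n}) :
  wise_intersecting r #|T| (full_star k T).
Proof.
apply/wise_intersectingP => A AS; apply/subset_leq_card/bigcapsP => i _.
by have := AS i; rewrite inE => /andP[].
Qed.

Lemma full_star_uniform n k (T : {set 'I_n}) : k_uniform k (full_star k T).
Proof. by apply/subsetP => A; rewrite !inE => /andP[]. Qed.

Lemma wise_intersecting_eq0 n k r t (F : {set {set 'I_n}}) :
  0 < r -> k < t -> k_uniform k F -> wise_intersecting r t F -> F = set0.
Proof.
case: r => // r _ kt /subsetP uF /wise_intersectingP wF; apply/setP => A; rewrite [RHS]inE.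
apply/negP => AF; have := wF (fun=> A) (fun=> AF); rewrite leqNgt => /negP; apply.
have := uF _ AF; rewrite inE => /eqP cA; apply: leq_ltn_trans kt.
by rewrite -cA; apply/subset_leq_card/(bigcap_inf ord0).
Qed.

(** * Shifting *)

Definition swap_set n (i j : 'I_n) (A : {set 'I_n}) : {set 'I_n} :=
  [set x | tperm i j x \in A].

(** The Erdős-Ko-Rado shift at a single set; the family enters because a move onto an existing
    member is blocked. *)
Definition shift_set n (i j : 'I_n) (F : {set {set 'I_n}}) (A : {set 'I_n}) :=
  if [&& j \in A, i \notin A & swap_set i j A \notin F] then swap_set i j A else A.

Definition shift n (i j : 'I_n) (F : {set {set 'I_n}}) : {set {set 'I_n}} :=
  [set shift_set i j F A | A in F].

Definition shifted n (F : {set {set 'I_n}}) : bool :=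
  [forall i : 'I_n, forall j : 'I_n, (i < j) ==> (shift i j F == F)].

Lemma swap_setK n (i j : 'I_n) : involutive (swap_set i j).
Proof. by move=> A; apply/setP=> x; rewrite !inE tpermK. Qed.

Lemma card_swap_set n (i j : 'I_n) (A : {set 'I_n}) : #|swap_set i j A| = #|A|.
Proof.
have -> : swap_set i j A = tperm i j @^-1: A by apply/setP=> x; rewrite !inE.
exact/card_preimset/perm_inj.
Qed.

Lemma swap_setS n (i j : 'I_n) (A B : {set 'I_n}) :
  (swap_set i j A \subset B) = (A \subset swap_set i j B).
Proof.
apply/subsetP/subsetP => H x; rewrite ?inE => xA.
  by apply: H; rewrite inE tpermK.
by have := H _ xA; rewrite inE tpermK.
Qed.

Lemma swap_setE n (i j : 'I_n) (A : {set 'I_n}) : j \in A -> i \notin A ->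
  swap_set i j A = i |: (A :\ j).
Proof.
move=> jA iA; apply/setP=> x; rewrite !inE; case: tpermP => [->|->|/eqP/negPf-> /eqP/negPf->] //=.
  by rewrite eqxx.
by rewrite eqxx (negPf iA) orbF; apply/esym/negbTE; apply: contraNneq iA => <-.
Qed.

Lemma shift_set_inj n (i j : 'I_n) (F : {set {set 'I_n}}) : {in F &, injective (shift_set i j F)}.
Proof.
move=> A B AF BF; rewrite /shift_set.
case: ifP => [/and3P[_ _ sA]|_]; case: ifP => [/and3P[_ _ sB]|_] //.
- exact: (can_inj (swap_setK i j)).
- by move=> e; rewrite e BF in sA.
- by move=> e; rewrite -e AF in sB.
Qed.

Lemma card_shift n (i j : 'I_n) (F : {set {set 'I_n}}) : #|shift i j F| = #|F|.
Proof. exact/card_in_imset/shift_set_inj. Qed.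

Lemma shift_uniform n k (i j : 'I_n) (F : {set {set 'I_n}}) :
  k_uniform k F -> k_uniform k (shift i j F).
Proof.
move=> /subsetP uF; apply/subsetP => _ /imsetP[A /uF cA ->].
by rewrite inE in cA; rewrite /shift_set inE; case: ifP => // _; rewrite card_swap_set.
Qed.

Lemma mem_shift n (i j : 'I_n) (F : {set {set 'I_n}}) (A : {set 'I_n}) : A \in F ->
  ~~ [&& j \in A, i \notin A & swap_set i j A \notin F] -> A \in shift i j F.
Proof. by move=> AF H; apply/imsetP; exists A => //; rewrite /shift_set (negPf H). Qed.

Lemma mem_shift_swap n (i j : 'I_n) (F : {set {set 'I_n}}) (A : {set 'I_n}) :
  A \in F -> j \in A -> i \notin A ->
  swap_set i j A \in shift i j F.
Proof.
move=> AF jA iA; case sA : (swap_set i j A \in F).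
  by apply: mem_shift => //; rewrite !inE tpermR (negPf iA).
by apply/imsetP; exists A => //; rewrite /shift_set jA iA sA.
Qed.

(** A kept set that could have moved was blocked, so its swap lies in [F] as well; for a moved set
    the swap is the original. *)
Variant shift_spec n (i j : 'I_n) (F : {set {set 'I_n}}) (A : {set 'I_n}) : Prop :=
  | ShiftKept of A \in F & (j \in A -> i \notin A -> swap_set i j A \in F)
  | ShiftMoved of A \notin F & i \in A & j \notin A & swap_set i j A \in F.

Lemma shiftP n (i j : 'I_n) (F : {set {set 'I_n}}) (A : {set 'I_n}) :
  A \in shift i j F -> shift_spec i j F A.
Proof.
move=> /imsetP[B BF]; rewrite /shift_set; case: ifP => [/and3P[jB iB sB]|H] ->.
  by right; rewrite ?swap_setK // inE ?tpermL ?tpermR.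
by left => // jB iB; move: H; rewrite jB iB /= => /negbFE.
Qed.

(** Moved sets are replaced by their originals [C l]. If [i] is in the intersection [I], then the
    swap of [I] contains the intersection of the originals. Otherwise some kept [A m] lacks [i];
    using its swap when it contains [j] gives members of [F] whose intersection avoids both [i] and
    [j], hence lies in [I]. *)
Lemma shift_wise_intersecting n r t (i j : 'I_n) (F : {set {set 'I_n}}) :
  wise_intersecting r t F -> wise_intersecting r t (shift i j F).
Proof.
move=> /wise_intersectingP wF; apply/wise_intersectingP => A AS.
have [AF|] := boolP [forall l, A l \in F]; first by apply: wF; apply/forallP.
rewrite negb_forall => /existsP[l0 l0F].
set I := \bigcap_(l < r) A l.
pose C l := if A l \in F then A l else swap_set i j (A l).
have CF l : C l \in F.
  by rewrite /C; case: ifP => // nF; case: (shiftP (AS l)) => //; rewrite nF.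
have [i0 j0] : i \in A l0 /\ j \notin A l0.
  by case: (shiftP (AS l0)) => //; rewrite (negPf l0F).
have C0 : i \notin C l0 by rewrite /C (negPf l0F) inE tpermL.
have outE l x : x != i -> x != j -> (x \in swap_set i j (A l)) = (x \in A l).
  by move=> xi xj; rewrite inE tpermD // eq_sym.
have bigE (D : 'I_r -> {set 'I_n}) x :
    reflect (forall l, x \in D l) (x \in \bigcap_(l < r) D l).
  by apply: (iffP bigcapP) => H l //; apply: H.
have [iI|iI] := boolP (i \in I).
  apply: leq_trans (wF C CF) _.
  rewrite -(card_swap_set i j I); apply/subset_leq_card/subsetP => x /bigE xC.
  rewrite inE; case: tpermP => [xi|_ //|/eqP xi /eqP xj].
    by have := xC l0; rewrite xi (negPf C0).
  by apply/bigE => l; have := xC l; rewrite /C; case: ifP => // _; rewrite outE.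
have [m im] : exists m, i \notin A m.
  apply/existsP; rewrite -negb_forall; apply: contra iI => /forallP H; exact/bigE.
have [mF msF] : A m \in F /\ (j \in A m -> swap_set i j (A m) \in F).
  case: (shiftP (AS m)) => [? H|_ H]; last by rewrite H in im.
  by split=> // jm; apply: H.
pose D l := if (l == m) && (j \in A m) then swap_set i j (A m) else C l.
have DF l : D l \in F by rewrite /D; case: ifP => // /andP[_ /msF].
apply: leq_trans (wF D DF) _; apply/subset_leq_card/subsetP => x /bigE xD.
have ml0 : (l0 == m) = false by apply/eqP => e; rewrite -e i0 in im.
have xi : x != i by apply: contraTneq (xD l0) => ->; rewrite /D ml0.
have xj : x != j.
  apply: contraTneq (xD m) => ->; rewrite /D eqxx /=; case: ifP => [_|jm].
    by rewrite inE tpermR.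
  by rewrite /C mF jm.
apply/bigE => l; have := xD l; rewrite /D /C.
by case: ifP => [/andP[/eqP-> _]|_]; [|case: ifP => // _]; rewrite outE.
Qed.

(* Two sets of [F] may disagree on whether they contain [i] or [j], but every
   set containing [j |: T] lies in [F]; a third member [G], chosen to meet [B]
   only in [T], brings the common intersection down to [T :\ i]. *)
Lemma unshift_full_star n k r t (i j : 'I_n) (F : {set {set 'I_n}}) (T : {set 'I_n}) :
  2 < r -> t < k -> 2 * k <= n -> k_uniform k F -> wise_intersecting r t F ->
  #|T| = t -> shift i j F = full_star k T ->
  exists T' : {set 'I_n}, #|T'| = t /\ F = full_star k T'.
Proof.
move=> r2 tk kn uF wF cT SE.
suff [T' cT' TF] : exists2 T' : {set 'I_n}, #|T'| = t & forall B, B \in F -> T' \subset B.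
  exists T'; split => //; apply/eqP; rewrite eqEcard -(card_shift i j F) SE.
  rewrite !card_full_star ?cT ?cT' ?leqnn ?andbT //; try exact: ltnW.
  apply/subsetP => B BF; rewrite inE TF // andbT.
  by have := subsetP uF _ BF; rewrite inE.
have [H|] := boolP [forall (A | A \in F), T \subset A].
  by exists T => // B BF; move/forall_inP: H; apply.
rewrite negb_forall => /existsP[A]; rewrite negb_imply => /andP[AF TA].
have ST B : B \in shift i j F -> T \subset B by rewrite SE inE => /andP[].
have [jA iA] : j \in A /\ i \notin A.
  case: (boolP [&& j \in A, i \notin A & swap_set i j A \notin F]) => [/and3P[]//|].
  by move=> /(mem_shift AF)/ST; rewrite (negPf TA).
have TsA := ST _ (mem_shift_swap AF jA iA).
have iT : i \in T.
  apply: contraR TA => iT; apply/subsetP => x xT.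
  have := subsetP TsA _ xT; rewrite swap_setE // !inE => /orP[/eqP e|/andP[] //].
  by rewrite -e xT in iT.
have jT : j \notin T.
  by apply: contra iA => /(subsetP TsA); rewrite inE tpermR.
(* The new centre is [T] with [i] replaced by [j]. The one critical case is a kept [B] without [j],
   which is refuted below. *)
exists (swap_set i j T); first by rewrite card_swap_set.
move=> B BF; have [|] := boolP [&& j \in B, i \notin B & swap_set i j B \notin F].
  by case/and3P=> jB iB _; rewrite swap_setS; apply/ST/mem_shift_swap.
move=> /(mem_shift BF)/ST TB; have [jB|jB] := boolP (j \in B).
  apply/subsetP => x; rewrite inE; case: tpermP => [-> _|-> _ //|_ _]; exact: (subsetP TB).
exfalso.
have cB : #|B| = k by have := subsetP uF _ BF; rewrite inE => /eqP.
have cjB : #|~: (j |: B)| = n - k.+1 by rewrite cardsCs setCK card_ord cardsU1 jB cB.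
(* There is room for [U] outside [j |: B] because [n - k - 1 >= k - t - 1]. *)
have kt : k - t.+1 <= #|~: (j |: B)| by rewrite cjB; move: tk kn; clear; lia.
have [U UD cU] := exists_subset_card kt.
have cjT : #|j |: T| = t.+1 by rewrite cardsU1 jT cT.
have UjB x : x \in U -> (x != j) && (x \notin B).
  by move=> /(subsetP UD); rewrite !inE negb_or.
pose G := (j |: T) :|: U.
(* [G] is in the star and contains [j], while a moved set never contains [j]; so [G] was in [F]
   already. *)
have GF : G \in F.
  have /shiftP[//|_ _] : G \in shift i j F.
    have TG : T \subset G by apply/subsetP => x xT; rewrite !inE xT orbT.
    rewrite SE inE TG andbT cardsU cjT cU.
    have -> : (j |: T) :&: U = set0.
      apply/setP => x; rewrite !inE; apply/negP => /andP[xjT /UjB/andP[xj xB]].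
      by move: xjT; rewrite (negPf xj) /= => /(subsetP TB); rewrite (negPf xB).
    by rewrite cards0 subn0 subnKC.
  by rewrite !inE eqxx.
have := wise_intersecting3 r2 wF AF BF GF.
apply/negP; rewrite -ltnNge.
have /leq_ltn_trans : #|A :&: B :&: G| <= #|T :\ i|.
  apply/subset_leq_card/subsetP => x; rewrite !inE => /andP[/andP[xA xB]].
  have -> : x != i by apply: contraNneq iA => <-.
  case/orP => [/orP[/eqP e|//]|/UjB]; first by rewrite -e xB in jB.
  by rewrite xB andbF.
by apply; rewrite -cT (cardsD1 i T) iT.
Qed.

(** The termination measure for repeated shifting: each moved set trades [j] for the smaller [i]. *)
Lemma shift_sum_lt n (i j : 'I_n) (F : {set {set 'I_n}}) : i < j -> shift i j F != F ->
  \sum_(A in shift i j F) \sum_(x in A) x < \sum_(A in F) \sum_(x in A) (x : nat).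
Proof.
move=> ij SF; rewrite big_imset /=; last exact: shift_set_inj.
pose M := [pred A : {set 'I_n} | [&& j \in A, i \notin A & swap_set i j A \notin F]].
have swlt (A : {set 'I_n}) : j \in A -> i \notin A ->
    \sum_(x in swap_set i j A) x < \sum_(x in A) (x : nat).
  move=> jA iA; rewrite swap_setE // big_setU1 ?inE ?(negPf iA) ?andbF //=.
  by rewrite [X in _ < X](big_setD1 j) //= ltn_add2r.
have [A AF MA] : exists2 A, A \in F & M A.
  apply/exists_inP; apply: contraR SF => /exists_inPn H; apply/eqP.
  rewrite -[RHS]imset_id; apply: eq_in_imset => A /H /negPf.
  by rewrite /M /shift_set /= => ->.
rewrite (bigD1 A) //= [X in _ < X](bigD1 A) //= -addSn leq_add //.
  by move: MA => /= MA; rewrite /shift_set MA; case/and3P: MA => *; apply: swlt.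
apply: leq_sum => B _; rewrite /shift_set; case: ifP => // /and3P[jB iB _].
exact/ltnW/swlt.
Qed.

Lemma shifted_or_exists n (F : {set {set 'I_n}}) :
  shifted F \/ exists i j : 'I_n, i < j /\ shift i j F != F.
Proof.
have [|] := boolP (shifted F); first by left.
rewrite negb_forall => /existsP[i]; rewrite negb_forall => /existsP[j].
by rewrite negb_imply => /andP[ij H]; right; exists i, j.
Qed.

(** * Prefix counts and domination *)

Definition prefix_card n (A : {set 'I_n}) (x : nat) : nat := #|[set y in A | y < x]|.

Lemma take_enum_ord n m : m <= n -> take m (enum 'I_n) = [seq y : 'I_n <- enum 'I_n | y < m].
Proof.
move=> mn; apply: (inj_map val_inj).
by rewrite map_take -(filter_map val (fun y => y < m)) val_enum_ord
  take_iota (minn_idPl mn) (filter_iota_ltn 0).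
Qed.

Lemma prefix_cardE n (A : {set 'I_n}) m : m <= n ->
  prefix_card A m = count [in A] (take m (enum 'I_n)).
Proof.
move=> mn; rewrite take_enum_ord // count_filter /prefix_card cardE {1}/enum_mem -enumT size_filter.
by apply: eq_count => y; rewrite /= !inE.
Qed.

Lemma card_ord_lt n m : #|[set y : 'I_n | y < m]| = minn n m.
Proof.
have [nm|mn] := leqP n m.
  rewrite (_ : [set y | _] = setT) ?cardsT ?card_ord ?(minn_idPl nm) //.
  by apply/setP=> y; rewrite !inE (leq_trans (ltn_ord y)).
rewrite (_ : [set y : 'I_n | y < m] = [set y in [set: 'I_n] | y < m]); last first.
  by apply/setP => y; rewrite !inE.
rewrite -/(prefix_card _ _) prefix_cardE ?(ltnW mn) //.
have /eqP -> : count [in [set: 'I_n]] (take m (enum 'I_n)) == size (take m (enum 'I_n)).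
  by rewrite -all_count; apply/allP => y _; rewrite /= inE.
by rewrite size_takel ?size_enum_ord ?(minn_idPr _) // ltnW.
Qed.

Lemma shiftedP n (F : {set {set 'I_n}}) (i j : 'I_n) (A : {set 'I_n}) : shifted F -> i < j ->
  A \in F -> j \in A -> i \notin A -> swap_set i j A \in F.
Proof.
move=> /forallP/(_ i)/forallP/(_ j)/implyP H /H /eqP SF AF jA iA.
by rewrite -SF; apply: mem_shift_swap.
Qed.

(** Induction on [#|A :\: X|]. Let [j] be the least element of [A :\: X]. Comparing prefixes of
    length [j + 1] yields [i < j] in [X] but not in [A], and replacing [j] by [i] stays in [F],
    keeps domination and lowers the measure. *)
Lemma shifted_dominated n (F : {set {set 'I_n}}) (A X : {set 'I_n}) : shifted F -> A \in F ->
  (forall x, prefix_card A x <= prefix_card X x) -> exists2 B : {set 'I_n}, B \in F & B \subset X.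
Proof.
move=> sF; move: {2}#|A :\: X|.+1 (ltnSn #|A :\: X|) => m.
elim: m A => // m IH A; rewrite ltnS => cA AF AX.
have [AX0|] := boolP (A \subset X); first by exists A.
case/subsetPn => j0 jA0 jX0.
case: (@arg_minnP _ j0 [pred j | (j \in A) && (j \notin X)] val); first by rewrite /= jA0.
move=> j /= /andP[jA jX] jmin.
have AXlt y : y \in A -> y < j -> y \in X.
  move=> yA yj; apply: contraLR yj => yX; rewrite -leqNgt jmin //= yA //.
have [i iX [iA ij]] : exists2 i, i \in X & i \notin A /\ i < j.
  suff /subsetPn[i] : ~~ ([set y in X | y < j.+1] \subset [set y in A | y < j]).
    rewrite !inE => /andP[iX ij]; rewrite negb_and => H; exists i => //.
    have ij' : i < j.
      by rewrite ltn_neqAle -ltnS ij andbT; apply: contraNneq jX => /val_inj <-.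
    by move: H; rewrite ij' orbF.
  apply/negP => /subset_leq_card /(leq_trans (AX j.+1)); apply/negP; rewrite -ltnNge.
  apply: proper_card; apply/properP; split.
    by apply/subsetP=> y; rewrite !inE => /andP[-> /ltnW].
  by exists j; rewrite !inE ?jA ?ltnSn ?ltnn // andbF.
have eS := swap_setE jA iA.
apply: (IH (swap_set i j A)); last 1 first.
(* Below [j] the swapped set lies in [X]; beyond [j] its prefix counts are those of [A]. *)
- move=> x; rewrite /prefix_card eS.
  have [xj|jx] := leqP x j.
    apply: subset_leq_card; apply/subsetP => y; rewrite !inE => /andP[+ yx].
    rewrite yx andbT => /orP[/eqP -> //|/andP[_ yA]].
    by apply: AXlt => //; apply: leq_trans xj.
  apply: leq_trans (AX x); rewrite /prefix_card.
  have -> : [set y in i |: A :\ j | y < x] = i |: ([set y in A | y < x] :\ j).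
    apply/setP => y; rewrite !inE; case: eqP => [->|_] /=; last by rewrite andbA.
    by rewrite (ltn_trans ij jx).
  by rewrite cardsU1 !inE (negPf iA) andbF [leqRHS](cardsD1 j) !inE jA jx leq_add2r leq_b1.
- apply: leq_trans cA; rewrite eS; apply: proper_card; apply/properP; split.
    apply/subsetP=> y; rewrite !inE => /andP[yX /orP[/eqP e|/andP[_ ->]]]; last by rewrite yX.
    by rewrite e iX in yX.
  by exists j; rewrite !inE ?jA ?jX //= eqxx orbF; apply: contraTneq ij => ->; rewrite ltnn.
- exact: shiftedP sF ij AF jA iA.
Qed.

(* Frankl's lattice path lemma. If [A] violated it, it would be dominated by the
   complement of each residue class [t - 1 + s + rN], [s < r], giving [r] members
   of [F] whose common elements are all below [t - 1]. *)
Lemma shifted_hits_line n r t (F : {set {set 'I_n}}) (A : {set 'I_n}) :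
  0 < r -> 0 < t -> shifted F -> wise_intersecting r t F -> A \in F ->
  exists2 i, t + r * i <= n & t + r.-1 * i <= prefix_card A (t + r * i).
Proof.
move=> r0 t0 sF wF AF.
have [/existsP[i /andP[i1 i2]]|noi] :=
    boolP [exists i : 'I_n.+1, (t + r * i <= n) && (t + r.-1 * i <= prefix_card A (t + r * i))].
  by exists i.
have {}noi i : t + r * i <= n -> prefix_card A (t + r * i) < t + r.-1 * i.
  move=> H; have ilt : i < n.+1 by nia.
  move: noi; rewrite negb_exists => /forallP/(_ (Ordinal ilt)) /=.
  by rewrite H /= -ltnNge.
pose bad s (y : 'I_n) := (t.-1 <= y) && ((y - t.-1) %% r == s).
pose X s := [set y : 'I_n | ~~ bad s y].
have dom s x : prefix_card A x <= prefix_card (X s) x.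
  wlog xn : x / x <= n => [H|].
    have [xn|nx] := leqP x n; first exact: H.
    have E (Y : {set 'I_n}) : prefix_card Y x = prefix_card Y n.
      by apply: eq_card => y; rewrite !inE ltn_ord (ltn_trans (ltn_ord y) nx).
    by rewrite !E; apply: H.
  have cX : prefix_card (X s) x + #|[set y | bad s y & y < x]| = x.
    rewrite -[RHS](minn_idPr xn) -card_ord_lt -(cardsID (X s) [set y : 'I_n | y < x]).
    congr (_ + _); apply: eq_card => y; rewrite !inE ?negbK andbC //.
  have [xt|tx] := leqP x t.-1.
    have : #|[set y | bad s y & y < x]| = 0.
      apply/eqP; rewrite cards_eq0; apply/eqP/setP => y; rewrite !inE /bad.
      by apply/negP => /andP[/andP[ty _] yx]; lia.
    have : prefix_card A x <= x.
      rewrite -[leqRHS](minn_idPr xn) -card_ord_lt; apply/subset_leq_card/subsetP => y.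
      by rewrite !inE => /andP[].
    lia.
  (* [t + r * q] is the last checkpoint not beyond [x]. The failure of the line condition there
     makes [A] miss at least [q + 1] elements below [x], while [X s] misses at most [q + 1]. *)
  set q := (x - t) %/ r.
  have qx : t + r * q <= x.
    by have := leq_trunc_div (x - t) r; rewrite -/q mulnC; lia.
  have xq : x < t + r * q.+1.
    by have := ltn_ceil (x - t) r0; rewrite -/q mulnC; lia.
  have cbad : #|[set y | bad s y & y < x]| <= q.+1.
    rewrite -[q.+1]card_ord -(card_in_imset
      (f := fun y : 'I_n => inord ((y - t.-1) %/ r) : 'I_q.+1)).
      exact: max_card.
    have lt y : y < x -> (y - t.-1) %/ r < q.+1.
      by move=> yx; rewrite ltn_divLR //; nia.
    move=> y z; rewrite !inE => /andP[/andP[ty /eqP ys] yx] /andP[/andP[tz /eqP zs] zx].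
    move=> /(congr1 val); rewrite /= !inordK ?lt // => e; apply: val_inj => /=.
    have : y - t.-1 = z - t.-1 by rewrite (divn_eq (y - _) r) e ys -zs -divn_eq.
    lia.
  have := noi q (leq_trans qx xn).
  have : prefix_card A x <= prefix_card A (t + r * q) + (x - (t + r * q)).
    pose I := [set y : 'I_n | y < t + r * q].
    have := cardsID I [set y in A | y < x].
    have := cardsID I [set y : 'I_n | y < x].
    have -> : [set y : 'I_n | y < x] :&: I = I.
      apply/setP=> y; rewrite !inE andbC; case: ltnP => //= yq.
      exact: leq_trans qx.
    have -> : [set y in A | y < x] :&: I = [set y in A | y < t + r * q].
      apply/setP=> y; rewrite !inE -andbA; congr (_ && _); rewrite andbC; case: ltnP => //= yq.
      exact: leq_trans qx.
    have : #|[set y in A | y < x] :\: I| <= #|[set y : 'I_n | y < x] :\: I|.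
      by apply/subset_leq_card/setSD/subsetP => y; rewrite !inE => /andP[].
    have -> : #|I| = t + r * q by rewrite card_ord_lt (minn_idPr (leq_trans qx xn)).
    rewrite card_ord_lt (minn_idPr xn) /prefix_card => H1 H2 <-; rewrite leq_add2l.
    by apply: leq_trans H1 _; rewrite -[X in X - _]H2 addKn.
  have : r * q = r.-1 * q + q by nia.
  lia.
have /fin_all_exists2[B BF BX] (s : 'I_r) : exists2 B : {set 'I_n}, B \in F & B \subset X s.
  by apply: shifted_dominated sF AF (dom s).
have /wise_intersectingP/(_ B BF) := wF.
(* Any [y >= t - 1] is excluded by the class of its own residue. *)
have : #|\bigcap_(s < r) B s| <= #|[set y : 'I_n | y < t.-1]|.
  apply/subset_leq_card/subsetP => y /bigcapP yB; rewrite inE ltnNge; apply/negP => ty.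
  have sr : (y - t.-1) %% r < r by rewrite ltn_mod.
  have := subsetP (BX (Ordinal sr)) _ (yB _ isT).
  by rewrite inE /bad ty eqxx.
by rewrite card_ord_lt; lia.
Qed.

(** * Counting lattice paths *)

(* The path [s] ([true] for members of the set) starts at distance [t] from the
   line; each [true] brings it one step closer and each [false] takes it [r - 1]
   steps away. *)
Fixpoint hits (r t : nat) (s : bitseq) : bool :=
  (t == 0) || if s is b :: s' then hits r (if b then t.-1 else t + r.-1) s' else false.

Lemma hits_count r t s : hits r t s -> t <= count id s.
Proof.
elim: s t => [|b s IH] [|t] //=; case: b => /IH //=; rewrite add0n.
by apply: leq_trans; rewrite leq_addr.
Qed.

(** Links Frankl's condition to the recursion: a [true] lowers [t] and keeps [i], a [false] turns
    [(t, i)] into [(t + r - 1, i - 1)]. With [i = 0] a [false] cannot occur while [t > 0], as all of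
    the first [t] letters must be [true]. *)
Lemma prefix_hits r t i s : 0 < r -> t + r * i <= size s ->
  t + r.-1 * i <= count id (take (t + r * i) s) -> hits r t s.
Proof.
move=> r0; elim: s t i => [|b s IH] [|t] i //=; case: b => /=.
by move=> H1 H2; apply: (IH _ i); lia.
case: i => [|i] H H'.
  have := count_size id (take (t + r * 0) s); rewrite size_take_min.
  by have := geq_minl (t + r * 0) (size s); lia.
apply: (IH _ i).
  by move: H; lia.
have -> : t.+1 + r.-1 + r * i = t + r * i.+1 by lia.
by lia.
Qed.

(** Built letter by letter, so that [num_hits] splits according to the first step of the path. *)
Fixpoint bitseqs n : seq bitseq :=
  if n is n'.+1 then map (cons true) (bitseqs n') ++ map (cons false) (bitseqs n')
  else [:: [::]].

Lemma mem_bitseqs n s : size s = n -> s \in bitseqs n.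
Proof.
elim: n s => [|n IH] [|b s] //= [/IH sn]; rewrite mem_cat.
by case: b; rewrite map_f ?orbT.
Qed.

Definition num_hits r n k t : nat :=
  count (fun s => (count id s == k) && hits r t s) (bitseqs n).

Lemma num_hits0 r n k t : k < t -> num_hits r n k t = 0.
Proof.
move=> kt; apply/eqP; rewrite eqn0Ngt -has_count; apply/hasPn => s _.
by apply/andP => -[/eqP ck /hits_count]; rewrite ck leqNgt kt.
Qed.

Lemma count_bitseqs n k : count (fun s => count id s == k) (bitseqs n) = 'C(n, k).
Proof.
elim: n k => [|n IH] k /=; first by case: k.
rewrite count_cat !count_map; case: k => [|k].
  by rewrite (eq_count (a2 := pred0)) // count_pred0 add0n bin0 -(bin0 n) -IH.
by rewrite binS -!IH addnC.
Qed.

Lemma double_bin_pred m j : 0 < j -> 2 * j <= m -> 2 * 'C(m.-1, j.-1) <= 'C(m, j).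
Proof.
case: j m => [|j] [|m] //= _ H; rewrite -(leq_pmul2l (ltn0Sn j)) -mul_bin_diag mulnA leq_mul2r.
by rewrite mulnC H orbT.
Qed.

(** The ratio of ['C(m - 1, j - 1)] to ['C(m, j)] is [j / m], at most 1/2, and [2 * j <= m] survives
    lowering both by one. *)
Lemma exp2_bin m j a : a <= j -> 2 * j <= m -> 2 ^ a * 'C(m - a, j - a) <= 'C(m, j).
Proof.
move=> aj jm; elim: a aj => [|a IH] aj; first by rewrite !subn0 mul1n.
apply: leq_trans (IH (ltnW aj)); rewrite expnSr -mulnA leq_mul2l; apply/orP; right.
by rewrite !subnS; apply: double_bin_pred; lia.
Qed.

(** * Sets as bit sequences *)

Definition bits n (A : {set 'I_n}) : bitseq := [seq x \in A | x <- enum 'I_n].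

Lemma size_bits n (A : {set 'I_n}) : size (bits A) = n.
Proof. by rewrite size_map size_enum_ord. Qed.

Lemma bits_inj n : injective (@bits n).
Proof.
move=> A B /eq_in_map E; apply/setP=> x; apply: E; exact: mem_enum.
Qed.

Lemma count_take_bits n (A : {set 'I_n}) m : m <= n ->
  count id (take m (bits A)) = prefix_card A m.
Proof. by move=> mn; rewrite prefix_cardE // -map_take count_map. Qed.

Lemma prefix_card_full n (A : {set 'I_n}) : prefix_card A n = #|A|.
Proof. by apply: eq_card => y; rewrite !inE ltn_ord andbT. Qed.

Lemma card_le_num_hits n r k t (F : {set {set 'I_n}}) :
  (forall A : {set 'I_n}, A \in F -> #|A| = k /\ hits r t (bits A)) ->
  #|F| <= num_hits r n k t.
Proof.
move=> H; rewrite cardE -(size_map (@bits n)) /num_hits -size_filter.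
apply: uniq_leq_size; first by rewrite (map_inj_uniq (@bits_inj n)) enum_uniq.
move=> _ /mapP[A AF ->]; rewrite mem_enum in AF; have [cA hA] := H A AF.
rewrite mem_filter hA mem_bitseqs ?size_bits // !andbT.
by rewrite -[bits A]take_size size_bits count_take_bits // prefix_card_full cA.
Qed.

Definition initial_set n t : {set 'I_n} := [set y : 'I_n | y < t].

Local Open Scope ring_scope.

(** Induction on the first step, from [t + 1]. A [true] contributes at most [b ^+ t * C]. A [false]
    contributes at most [b ^+ (t + r)] times a binomial that [exp2_bin] bounds by [C / 2 ^+ r.-1].
    The condition on [b] makes the sum at most [b ^+ t.+1 * C]. The condition [2 * k <= n + t]
    passes to both branches. *)
Lemma num_hits_le (R : realFieldType) (b : R) (r n k t : nat) :
  (1 < r)%N -> 0 <= b -> 1 + b ^+ r / 2 ^+ r.-1 <= b ->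
  (t <= k)%N -> (2 * k <= n + t)%N ->
  (num_hits r n k t)%:R <= b ^+ t * 'C(n - t, k - t)%:R.
Proof.
move=> r0 b0 hb; elim: n k t => [|n IH] k t tk kn.
  have -> : k = t by lia.
  have -> : t = 0%N by lia.
  by rewrite /num_hits /= expr0 mul1r.
case: t tk kn => [|t] tk kn.
  rewrite expr0 mul1r !subn0 -count_bitseqs ler_nat /num_hits.
  by apply: sub_count => s /andP[].
case: k tk kn => // k tk kn.
have -> : num_hits r n.+1 k.+1 t.+1 = (num_hits r n k t + num_hits r n k.+1 (t.+1 + r.-1))%N.
  by rewrite /num_hits /= count_cat !count_map.
rewrite natrD !subSS exprSr.
have H1 : (num_hits r n k t)%:R <= b ^+ t * 'C(n - t, k - t)%:R by apply: IH; lia.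
have bt : 0 <= b ^+ t by apply: exprn_ge0.
set C : R := 'C(n - t, k - t)%:R in H1 *.
have C0 : 0 <= C by apply: ler0n.
have H2 : (num_hits r n k.+1 (t.+1 + r.-1))%:R <= b ^+ t * (b ^+ r / 2 ^+ r.-1) * C.
  have [lt|ge] := ltnP k.+1 (t.+1 + r.-1).
    by rewrite num_hits0 // !mulr_ge0 // ?invr_ge0 exprn_ge0.
  apply: le_trans (IH _ _ ge _) _; first by lia.
  have -> : (t.+1 + r.-1 = t + r)%N by lia.
  rewrite exprD -!mulrA ler_wpM2l // ler_wpM2l ?exprn_ge0 //.
  rewrite ler_pdivlMl ?exprn_gt0 // /C -natrX -natrM ler_nat.
  apply: leq_trans (@exp2_bin (n - t) (k - t) r.-1 _ _); try lia.
  rewrite leq_mul2l; apply/orP; right.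
  have -> : (k.+1 - (t + r) = k - t - r.-1)%N by lia.
  by apply: leq_bin2l; lia.
apply: le_trans (lerD H1 H2) _.
by have := ler_wpM2l (mulr_ge0 bt C0) hb; lra.
Qed.

(** * Numerical estimates *)

Lemma expr1D_le_expR (R : realType) (e : R) t : 0 <= e -> (1 + e) ^+ t <= expR (t%:R * e).
Proof. by move=> e0; rewrite expRM_natl lerXn2r ?nnegrE ?expR_ge0 ?addr_ge0 ?expR_ge1Dx. Qed.

(** [2 < (9/8)^6] and [ln (9/8) <= 1/8]. *)
Lemma ln2_lt (R : realType) : ln 2 < 3 / 4 :> R.
Proof.
have : ln 2 < ln ((1 + 1 / 8) ^+ 6) :> R by rewrite ltr_ln ?posrE ?exprn_gt0 //; lra.
rewrite lnXn; last by lra.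
by have := @le_ln1Dx R (1 / 8); rewrite -mulr_natl => /(_ ltac:(lra)); lra.
Qed.

Lemma bernoulli (R : realFieldType) (x : R) n : x <= 1 -> 1 - n%:R * x <= (1 - x) ^+ n.
Proof.
move=> x1; elim: n => [|n IH]; first by rewrite mul0r subr0 expr0.
have := ler_wpM2r (_ : 0 <= 1 - x) IH; rewrite subr_ge0 => /(_ x1); rewrite -exprSr.
apply: le_trans; have : 0 <= n%:R * x ^+ 2 by rewrite mulr_ge0 ?sqr_ge0.
by rewrite -natr1; nra.
Qed.

(* For [r >= 7] take [b = 1 + 7 / (6 * 2^(r-1))]: then [b^r <= 7 / 6] by Bernoulli
   and [b^t <= 2^(7/12) < 3 / 2]; [r = 5] and [r = 6] need their own constants. *)
Lemma weight_root (R : realType) (r t : nat) : (1 <= t)%N ->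
  t%:R <= 2 ^+ (r - 2) * ln 2 - 2 :> R ->
  (4 < r)%N /\ exists b : R, [/\ 0 <= b, 1 + b ^+ r / 2 ^+ r.-1 <= b & b ^+ t < 3 / 2].
Proof.
move=> t1 htr; have l2 := ln2_lt R.
have l0 : 0 < ln 2 :> R by apply: ln_gt0; lra.
have t1' : 1 <= t%:R :> R by rewrite ler1n.
(* For [r <= 4] the hypothesis would give [t <= 4 * ln 2 - 2 < 1]. *)
have r4 : (4 < r)%N.
  rewrite ltnNge; apply/negP => r4.
  have : 2 ^+ (r - 2) <= 4 :> R.
    have -> : 4 = 2 ^+ 2 :> R by lra.
    by rewrite ler_weXn2l //; [lra|lia].
  nra.
split=> //.
have [r7|r7] := ltnP 6 r; last first.
  have [r5|r6] : r = 5%N \/ r = 6%N by lia.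
  - rewrite {}r5 /= in htr *.
    have t3 : (t <= 3)%N by rewrite -ltnS -(ltr_nat R); nra.
    exists (9 / 8); split; [lra|lra|].
    by apply: (@le_lt_trans _ _ ((9 / 8) ^+ 3)); [rewrite ler_weXn2l //; lra|lra].
  - rewrite {}r6 /= in htr *.
    have t9 : (t <= 9)%N by rewrite -ltnS -(ltr_nat R); nra.
    exists (25 / 24); split; [lra|lra|].
    by apply: (@le_lt_trans _ _ ((25 / 24) ^+ 9)); [rewrite ler_weXn2l //; lra|lra].
have N0 : 0 < 2 ^+ r.-1 :> R by apply: exprn_gt0.
have EN : 2 ^+ r.-1 = 2 * 2 ^+ (r - 2) :> R.
  by rewrite -exprS; congr (_ ^+ _); lia.
(* This is what [r * y <= 1/7] requires; at [r = 7] it reads [343/6 <= 64]. *)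
have Nr : (49%:R / 6) * r%:R <= 2 ^+ r.-1 :> R.
  have : (49 * r <= 6 * 2 ^ r.-1)%N.
    clear -r7; elim: r r7 => // r IH; rewrite ltnS leq_eqVlt => /orP[/eqP <- //|/[dup] r6 /IH].
    by case: r r6 {IH} => // r _ /=; rewrite expnS; lia.
  by rewrite -(ler_nat R) !natrM natrX; lra.
pose y : R := 7 / 6 / 2 ^+ r.-1.
have y0 : 0 < y by rewrite !divr_gt0 //; lra.
have yN : y * 2 ^+ r.-1 = 7 / 6 by rewrite /y divfK // gt_eqF.
have ry : r%:R * y <= 1 / 7 by nra.
exists (1 + y); split; first by lra.
  have b1 : (1 + y) ^+ r * (1 - r%:R * y) <= 1.
    have : (1 + y) ^+ r * (1 - y) ^+ r <= 1.
      rewrite -exprMn exprn_ile1 //; nra.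
    have r1 : 1 <= r%:R :> R by rewrite ler1n; lia.
    have : 1 - r%:R * y <= (1 - y) ^+ r.
      by apply: bernoulli; nra.
    have : 0 <= (1 + y) ^+ r by apply: exprn_ge0; lra.
    nra.
  have : (1 + y) ^+ r <= 7 / 6.
    have : 0 <= (1 + y) ^+ r by apply: exprn_ge0; lra.
    nra.
  rewrite lerD2l ler_pdivrMr // yN //.
(* The hypothesis bounds [t] by [2 ^+ r.-1 * ln 2 / 2], so [t * y <= 7/12 * ln 2]. Twelfth powers
   then reduce the claim to [2^7 = 128 < (3/2)^12]. *)
have : (1 + y) ^+ t <= expR (7 / 12 * ln 2).
  apply: le_trans (expr1D_le_expR _ (ltW y0)) _; rewrite ler_expR; nra.
move=> H; rewrite -(ltr_pXn2r (n := 12)) ?nnegrE //; [|by apply: exprn_ge0; lra|by lra].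
have : ((1 + y) ^+ t) ^+ 12 <= expR (7 / 12 * ln 2) ^+ 12.
  by rewrite lerXn2r ?nnegrE ?expR_ge0 ?exprn_ge0 //; lra.
have -> : expR (7 / 12 * ln 2) ^+ 12 = 2 ^+ 7 :> R.
  rewrite -expRM_natl -[2 in RHS](@lnK R) ?posrE // -expRM_natl; congr expR; lra.
lra.
Qed.

(** * The bound and its uniqueness *)

Local Open Scope nat_scope.

(* Everything in [F] and in the star of [initial_set] hits the line, so the
   members of [F] outside that star number at most [(b ^ t - 1) 'C(n - t, k - t)],
   while those inside fill at most half of the star. *)
Lemma shifted_card_lt (R : realFieldType) (b : R) n k r t (F : {set {set 'I_n}}) :
  (0 <= b)%R -> (1 + b ^+ r / 2 ^+ r.-1 <= b)%R -> (b ^+ t < 3 / 2)%R ->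
  2 < r -> 0 < t -> t <= k -> 2 * k <= n ->
  k_uniform k F -> wise_intersecting r t F -> shifted F ->
  ~~ (F \subset full_star k (initial_set n t)) -> #|F| < 'C(n - t, k - t).
Proof.
move=> b0 hb bt r2 t0 tk kn uF wF sF /subsetPn[G GF].
set T := initial_set n t; set S := full_star k T.
have cF (A : {set 'I_n}) : A \in F -> #|A| = k.
  by move=> /(subsetP uF); rewrite inE => /eqP.
have tn : t <= n by lia.
have cT : #|T| = t by rewrite card_ord_lt; apply/minn_idPr.
have cS : #|S| = 'C(n - t, k - t) by rewrite card_full_star cT.
rewrite inE (cF G GF) eqxx /= => TG.
have half := card_star_part r2 wF cT tk (leq_trans kn (leq_addr _ _)) GF TG.
have all_hit : #|S :|: F| <= num_hits r n k t.
  apply: card_le_num_hits => A; rewrite inE; case/orP => [|AF].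
    rewrite inE => /andP[/eqP cA TA]; split=> //.
    (* A set containing [[t]] meets the line at once, with [i = 0]. *)
    apply: (@prefix_hits _ _ 0); rewrite ?muln0 ?addn0 ?size_bits //; first by lia.
    rewrite count_take_bits // -{1}cT; apply/subset_leq_card/subsetP => y yT.
    by rewrite inE (subsetP TA) //; move: yT; rewrite inE.
  split; first exact: cF.
  have [|i i1 i2] := shifted_hits_line _ t0 sF wF AF; first by lia.
  by apply: (@prefix_hits _ _ i); rewrite ?size_bits ?count_take_bits //; lia.
have bnd : ((num_hits r n k t)%:R <= b ^+ t * 'C(n - t, k - t)%:R)%R.
  by apply: num_hits_le => //; lia.
have C0 : 0 < 'C(n - t, k - t) by rewrite bin_gt0; lia.
have lt : 2 * num_hits r n k t < 3 * 'C(n - t, k - t).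
  have : (b ^+ t * 'C(n - t, k - t)%:R < 3 / 2 * 'C(n - t, k - t)%:R)%R.
    by rewrite ltr_pM2r ?ltr0n.
  move=> /(le_lt_trans bnd); rewrite -(ltr_nat R) !natrM.
  lra.
(* Here [u = #|F :&: S|], [v = #|S :|: F|], [x = #|S|] and [y = #|F|], so
   [y = v + u - x < 3x/2 + x/2 - x]. *)
have count_lt (u v w x y : nat) :
  2 * u <= x -> v <= w -> 2 * w < 3 * x -> v + u = x + y -> y < x by lia.
by apply: count_lt half all_hit lt _; rewrite setIC cardsUI cS.
Qed.

(** Induction on the sum of all elements of all members: an unshifted family is replaced by a shift
    of the same size, and in the case of equality the star is pulled back through that shift. *)
Lemma card_wise_intersecting (R : realFieldType) (b : R) n k r t (F : {set {set 'I_n}}) :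
  (0 <= b)%R -> (1 + b ^+ r / 2 ^+ r.-1 <= b)%R -> (b ^+ t < 3 / 2)%R ->
  2 < r -> 0 < t -> t <= k -> 2 * k <= n ->
  k_uniform k F -> wise_intersecting r t F ->
  #|F| <= 'C(n - t, k - t) /\
  (#|F| = 'C(n - t, k - t) -> exists T : {set 'I_n}, #|T| = t /\ F = full_star k T).
Proof.
move=> b0 hb bt r2 t0 tk kn.
move: {2}(\sum_(A in F) \sum_(x in A) (x : nat)).+1
  (ltnSn (\sum_(A in F) \sum_(x in A) (x : nat))) => m.
elim: m F => // m IH F; rewrite ltnS => Fm uF wF.
have [sF|[i [j [ij SF]]]] := shifted_or_exists F.
  have cT : #|initial_set n t| = t by rewrite card_ord_lt; apply/minn_idPr; lia.
  have cS : #|full_star k (initial_set n t)| = 'C(n - t, k - t) by rewrite card_full_star cT.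
  have [FS|FS] := boolP (F \subset full_star k (initial_set n t)).
    split=> [|cF]; first by rewrite -cS subset_leq_card.
    by exists (initial_set n t); split=> //; apply/eqP; rewrite eqEcard FS cS cF leqnn.
  have lt := shifted_card_lt b0 hb bt r2 t0 tk kn uF wF sF FS.
  by split=> [|cF]; [exact: ltnW | rewrite cF ltnn in lt].
have [||le eq] := IH (shift i j F) (leq_trans (shift_sum_lt ij SF) Fm).
- exact: shift_uniform.
- exact: shift_wise_intersecting.
rewrite card_shift in le eq; split=> // cF.
have [T [cT ST]] := eq cF.
(* Pulling back needs [t < k]. If [k = t], the family is a single set, which is its own star. *)
case: (ltnP t k) => [tk'|kt]; first exact: (unshift_full_star r2 tk' kn uF wF cT ST).
have ek : k = t by apply/eqP; rewrite eqn_leq kt tk.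
move: cF; rewrite ek subnn bin0 => /eqP/cards1P[A FA].
have cA : #|A| = k by have := subsetP uF A; rewrite FA !inE => /(_ (eqxx _))/eqP.
exists A; split; first by rewrite cA ek.
rewrite FA; apply/setP => B; rewrite !inE; apply/eqP/andP => [->|[/eqP cB AB]].
  by rewrite cA ek.
by apply/esym/eqP; rewrite eqEcard AB cB cA ek leqnn.
Qed.

Lemma binz_subz n k t : binz (n - t) (k%:Z - t%:Z)%R = if t <= k then 'C(n - t, k - t) else 0.
Proof.
case: leqP => [tk|kt]; first by rewrite subzn.
by rewrite -opprB subzn ?(ltnW kt) //; have -> : t - k = (t - k).-1.+1 by lia.
Qed.

Local Open Scope ring_scope.

Theorem theorem1p6 (R : realType) (n k r t : nat)
  (hr : (2 <= r)%N) (ht : (1 <= t)%N) (hn0 : (0 < n)%N) (hk0 : (0 < k)%N)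
  (hn : Num.max (2 * k%:R)
          (t%:R * (t%:R - 1) / (2 * ln 2) + 2 * t%:R - 1) <= n%:R :> R)
  (htr : t%:R <= 2 ^+ (r - 2) * ln 2 - 2 :> R) :
  max_wise_intersecting n k r t = binz (n - t) (k%:Z - t%:Z) /\
  (forall F : {set {set 'I_n}},
     k_uniform k F -> wise_intersecting r t F ->
     #|F| = binz (n - t) (k%:Z - t%:Z) ->
     exists T : {set 'I_n}, #|T| = t /\ F = full_star k T).
Proof.
move: hn; rewrite ge_max => /andP[kn tn].
have {}kn : (2 * k <= n)%N by rewrite -(ler_nat R) natrM.
(* The quotient is nonnegative, so [n >= 2t - 1 >= t]. *)
have {}tn : (t <= n)%N.
  have t1 : 1 <= t%:R :> R by rewrite ler1n.
  have l0 : 0 < ln 2 :> R by apply: ln_gt0; lra.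
  have : 0 <= t%:R * (t%:R - 1) / (2 * ln 2) :> R.
    by rewrite divr_ge0 ?mulr_ge0 ?subr_ge0 //; lra.
  by rewrite -(ler_nat R); lra.
have [r4 [b [b0 hb bt]]] := weight_root ht htr.
have cT : #|initial_set n t| = t by rewrite card_ord_lt; apply/minn_idPr.
have r2 : (2 < r)%N by lia.
rewrite binz_subz; case: leqP => tk.
  have main F uF wF := @card_wise_intersecting R b n k r t F b0 hb bt r2 ht tk kn uF wF.
  split; last by move=> F uF wF; case: (main F uF wF).
  apply/eqP; rewrite eqn_leq; apply/andP; split.
    by apply/bigmax_leqP => F /andP[uF wF]; case: (main F uF wF).
  have <- : #|full_star k (initial_set n t)| = 'C(n - t, k - t) by rewrite card_full_star cT.
  apply: (leq_bigmax_cond (full_star k (initial_set n t))).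
  by rewrite full_star_uniform -{1}cT full_star_wise_intersecting.
(* For [k < t] every admissible family is empty, and so is the star of [[t]], which therefore serves
   as the required star. *)
have F0 F : k_uniform k F -> wise_intersecting r t F -> F = set0 :> {set {set 'I_n}}.
  by apply: wise_intersecting_eq0 => //; lia.
split.
  by apply/eqP; rewrite -leqn0; apply/bigmax_leqP => F /andP[uF wF]; rewrite (F0 F) // cards0.
move=> F uF wF _; exists (initial_set n t); split=> //.
rewrite (F0 F) //; apply/esym/(F0 _ (full_star_uniform _ _)).
by rewrite -{1}cT full_star_wise_intersecting.
Qed.
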